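(* Let $\pi$ be a regular multiforcing and $\xi\in|\pi|$. Then: (i) if $\mathrm{MT}(\pi)$ has the countable chain condition, $G\subseteq\mathrm{MT}(\pi)$ is generic over the ground universe $\mathbf V$, and $x\in\mathbf V[G]\cap2^\omega$, then $x\ne x_\xi[G]$ if and only if there is a small $\pi$-complete real name $c\subseteq\mathrm{MT}(\pi)\times(\omega\times2)$ (in $\mathbf V$), non-principal over $\pi$ at $\xi$, such that $x=c[G]$; (ii) if $c\subseteq\mathrm{MT}(\pi)\times(\omega\times2)$ is a $\pi$-complete real name, $\rho$ is a multiforcing such that $\rho$ avoids $c$ over $\pi$ at $\xi$, and $G\subseteq\mathrm{MT}(\pi\cup^{\mathrm{cw}}\rho)$ is generic over $\mathbf V$, then $c[G]\notin\bigcup_{Q\in\rho(\xi)}[Q]$.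
   Context: $\mathbf{PT}$: perfect trees $T\subseteq2^{<\omega}$; $[T]$ branches; $T|s=\{t\in T:s\subseteq t\lor t\subseteq s\}$; trees a.d. if their intersection is finite. Arboreal forcing: $\mathbb P\subseteq\mathbf{PT}$ with $T|u\in\mathbb P$ whenever $u\in T\in\mathbb P$; regular if for $S,T\in\mathbb P$, $[S]\cap[T]$ is clopen in $[S]$ or in $[T]$. $\mathbb P\sqsubset\mathbb Q$: every $T\in\mathbb P$ contains some $Q\in\mathbb Q$; every $Q\in\mathbb Q$ is covered by finitely many trees of $\mathbb P$; for $Q\in\mathbb Q,T\in\mathbb P$, $[Q]\cap[T]$ clopen in $[Q]$ and $T\not\subseteq Q$. Multiforcing: function $\pi$ with domain $|\pi|\subseteq\omega_1$ and arboreal forcings as values; regular if all values are regular; $\pi\sqsubset\rho$ iff $|\pi|\subseteq|\rho|$ and $\pi(\xi)\sqsubset\rho(\xi)$ for $\xi\in|\pi|$. Componentwise union $\pi\cup^{\mathrm{cw}}\rho$: domain $|\pi|\cup|\rho|$, value $\pi(\xi)$, $\rho(\xi)$, or $\pi(\xi)\cup\rho(\xi)$ according as $\xi$ is only in $|\pi|$, only in $|\rho|$, or in both. Multitree: function $p$ with finite domain $|p|\subseteq\omega_1$, values in $\mathbf{PT}$; $[p]=\{x\in(2^\omega)^{\omega_1}:\forall\xi\in|p|\,x(\xi)\in[p(\xi)]\}$; $\mathrm{MT}$ all multitrees; $\mathrm{MT}(\pi)=\{p:|p|\subseteq|\pi|,\ p(\xi)\in\pi(\xi)\}$ (the finite-support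 product), ordered by $q\le p$ iff $|p|\subseteq|q|$ and $q(\xi)\subseteq p(\xi)$ for $\xi\in|p|$. $p,q$ are sad if $p(\xi),q(\xi)$ are a.d. for some $\xi\in|p|\cap|q|$. For $G\subseteq\mathrm{MT}(\pi)$ generic, $x_\xi[G]$ is the unique real in $\bigcap\{[p(\xi)]:p\in G,\ \xi\in|p|\}$. Sealing: $u\sqsubseteq^{\mathrm{fin}}\bigvee Z$ means some finite $Z'\subseteq Z$ has $|v|=|u|$ for $v\in Z'$ and $[u]\subseteq\bigcup_{v\in Z'}[v]$. For $\Delta\subseteq\mathrm{MT}(\pi)$, $\pi\sqsubset_\Delta\rho$ means $\pi\sqsubset\rho$ and: whenever $p\in\mathrm{MT}(\pi)$, $u\in\mathrm{MT}(\rho)$, $|u|\subseteq|\pi|$, $|u|\cap|p|=\emptyset$, there is $q\in\mathrm{MT}(\pi)$, $q\le p$, $|q|\cap|u|=\emptyset$, with $u\sqsubseteq^{\mathrm{fin}}\bigvee\{u'\in\mathrm{MT}(\pi):|u'|=|u|,\ u'\cup q\in\Delta\}$. Real names: a real name is $c\subseteq\mathrm{MT}\times(\omega\times2)$ such that, with $K_{n,i}=\{p:\langle p,n,i\rangle\in c\}$, any $p\in K_{n,0},q\in K_{n,1}$ are sad; $K_n=K_{n,0}\cup K_{n,1}$; $c$ is small if every $K_n$ is countable; $c$ is $\pi$-complete if each $\{p\in\mathrm{MT}(\pi):\exists q\in K_n\,p\le q\}$ is pre-dense in $\mathrm{MT}(\pi)$. If $c\subseteq\mathrm{MT}(\pi)\times(\omega\times2)$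 and $G$ is a generic filter (on $\mathrm{MT}(\pi)$ or a larger set of multitrees containing it) then $c[G]\in2^\omega$ is defined by $c[G](n)=i$ iff $G\cap K_{n,i}\ne\emptyset$. $p$ directly forces $c(n)=i$ if $p\le q$ for some $q\in K_{n,i}$; directly forces $s\subset c$ if it directly forces $c(n)=s(n)$ for all $n<\mathrm{lh}(s)$; directly forces $c\notin[T]$ if it directly forces $s\subset c$ for some $s\in2^{<\omega}\setminus T$. $c$ is non-principal over $\pi$ at $\xi$ if $\{p\in\mathrm{MT}(\pi):\xi\in|p|,\ p\text{ directly forces }c\notin[p(\xi)]\}$ is open dense in $\mathrm{MT}(\pi)$. For $\pi\sqsubset\rho$, $\rho$ avoids $c$ over $\pi$ at $\xi$ if for each $Q\in\rho(\xi)$, $\pi\sqsubset_{\Delta_Q}\rho$ where $\Delta_Q=\{r\in\mathrm{MT}(\pi):\xi\in|r|,\ r\text{ directly forces }c\notin[Q]\}$. *)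

(* Defs.v *)
From mathcomp Require Export all_boot all_order finmap.
From mathcomp Require Export boolp classical_sets cardinality.
From mathcomp Require Export topology cantor.

Set Implicit Arguments.
Unset Strict Implicit.
Unset Printing Implicit Defensive.

Local Open Scope classical_set_scope.
Local Open Scope fmap_scope.
Local Open Scope order_scope.

Definition tree := set (seq bool).

Definition PT : set tree := [set T : tree |
  [/\ T !=set0,
      forall s t, prefix s t -> T t -> T s
    & forall s, T s ->
        exists t, [/\ prefix s t, T (rcons t false) & T (rcons t true)]]].

Definition branches (T : tree) : set cantor_space :=
  [set x | forall n, T (mkseq x n)].

Definition restr (T : tree) (s : seq bool) : tree :=
  [set t | T t /\ (prefix s t || prefix t s)].

Definition almost_disjoint (S T : tree) : Prop := finite_set (S `&` T).

(* A is clopen in B, for A included in B; `subspace B` carries the relative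
   topology on B (points outside B are isolated in it). *)
Definition clopen_in (A B : set cantor_space) : Prop :=
  clopen (A : set (subspace B)).

Definition arboreal (P : set tree) : Prop :=
  P `<=` PT /\ (forall T u, P T -> T u -> P (restr T u)).

Definition regular_arboreal (P : set tree) : Prop :=
  forall S T, P S -> P T ->
    clopen_in (branches S `&` branches T) (branches S) \/
    clopen_in (branches S `&` branches T) (branches T).

Definition arboreal_ext (P Q : set tree) : Prop :=
  [/\ forall T, P T -> exists2 S, Q S & S `<=` T,
      forall S, Q S -> exists D : set tree,
        [/\ finite_set D, D `<=` P & S `<=` \bigcup_(T in D) T]
    & forall S T, Q S -> P T ->
        clopen_in (branches S `&` branches T) (branches S) /\ ~ (T `<=` S)].

(* An ordered set has order type omega_1 iff it is an uncountable well-order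
   all of whose proper initial segments are countable. *)
Definition is_omega1 d (W : orderType d) : Prop :=
  [/\ well_founded (fun a b : W => a < b),
      ~ countable [set: W]
    & forall a : W, countable [set b : W | b < a]].

Section Multi.
Variable W : choiceType.

Definition multiforcing := W -> option (set tree).

Implicit Types (pi rho : multiforcing) (xi : W).

Definition mfdom pi : set W := [set xi | pi xi].
Definition mfval pi xi : set tree := odflt set0 (pi xi).

Definition is_multiforcing pi : Prop :=
  forall xi, mfdom pi xi -> arboreal (mfval pi xi).

Definition regular pi : Prop :=
  forall xi, mfdom pi xi -> regular_arboreal (mfval pi xi).

Definition mf_ext pi rho : Prop :=
  mfdom pi `<=` mfdom rho /\
  forall xi, mfdom pi xi -> arboreal_ext (mfval pi xi) (mfval rho xi).

Definition cwU pi rho : multiforcing := fun xi =>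
  match pi xi, rho xi with
  | Some P, Some Q => Some (P `|` Q)
  | Some P, None => Some P
  | None, o => o
  end.

(* Values need not be perfect here; MT_all and MT impose it. *)
Definition multitree := {fmap W -> tree}.

Implicit Types (p q r u v : multitree).

Definition mtval p xi : tree := odflt set0 p.[? xi].

Definition MT_all : set multitree :=
  [set p | forall xi, xi \in domf p -> PT (mtval p xi)].

Definition MT pi : set multitree :=
  [set p | forall xi, xi \in domf p -> mfdom pi xi /\ mfval pi xi (mtval p xi)].

(* q <= p, i.e. q is the stronger condition *)
Definition mle q p : Prop :=
  forall xi, xi \in domf p ->
    xi \in domf q /\ mtval q xi `<=` mtval p xi.

Definition mbranches p : set (W -> cantor_space) :=
  [set x | forall xi, xi \in domf p -> branches (mtval p xi) (x xi)].

Definition sad p q : Prop :=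
  exists xi, [/\ xi \in domf p, xi \in domf q
               & almost_disjoint (mtval p xi) (mtval q xi)].

Definition mdisjoint p q : Prop :=
  forall xi, ~ (xi \in domf p /\ xi \in domf q).

Definition compatible pi p q : Prop :=
  exists r, [/\ MT pi r, mle r p & mle r q].

Definition predense pi (D : set multitree) : Prop :=
  forall p, MT pi p -> exists2 q, D q & compatible pi p q.

Definition open_dense pi (D : set multitree) : Prop :=
  (forall p q, MT pi q -> D p -> mle q p -> D q) /\
  (forall p, MT pi p -> exists2 q, D q & mle q p).

Definition ccc pi : Prop :=
  forall A : set multitree, A `<=` MT pi ->
    (forall p q, A p -> A q -> p <> q -> ~ compatible pi p q) ->
    countable A.

Definition fin_covered u (Z : set multitree) : Prop :=
  exists Z' : set multitree,
    [/\ finite_set Z', Z' `<=` Z,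
        forall v, Z' v -> domf v = domf u
      & mbranches u `<=` \bigcup_(v in Z') mbranches v].

(* `catf u' q` is the union of u' and q, their domains being disjoint. *)
Definition seal pi (Delta : set multitree) rho : Prop :=
  mf_ext pi rho /\
  forall p u, MT pi p -> MT rho u ->
    (forall xi, xi \in domf u -> mfdom pi xi) -> mdisjoint u p ->
    exists q, [/\ MT pi q, mle q p, mdisjoint q u
      & fin_covered u [set u' | [/\ MT pi u', domf u' = domf u
                                  & Delta (catf u' q)]]].

Definition rname := set (multitree * (nat * bool)).

Implicit Types c : rname.

Definition Kni c n i : set multitree := [set p | c (p, (n, i))].
Definition Kn c n : set multitree := Kni c n false `|` Kni c n true.

Definition is_real_name c : Prop :=
  (forall k, c k -> MT_all k.1) /\
  (forall n p q, Kni c n false p -> Kni c n true q -> sad p q).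

Definition small c : Prop := forall n, countable (Kn c n).

Definition complete pi c : Prop :=
  forall n, predense pi [set p | MT pi p /\ exists2 q, Kn c n q & mle p q].

Definition name_in pi c : Prop := forall k, c k -> MT pi k.1.

Definition dforces_bit p c n i : Prop := exists2 q, Kni c n i q & mle p q.

Definition dforces_seq p c (s : seq bool) : Prop :=
  forall n, (n < size s)%N -> dforces_bit p c n (nth false s n).

Definition dforces_notin p c (T : tree) : Prop :=
  exists2 s, ~ T s & dforces_seq p c s.

Definition non_principal pi c xi : Prop :=
  open_dense pi [set p | [/\ MT pi p, xi \in domf p
                           & dforces_notin p c (mtval p xi)]].

Definition avoids rho c pi xi : Prop :=
  mf_ext pi rho /\
  forall Q, mfval rho xi Q ->
    seal pi [set r | [/\ MT pi r, xi \in domf r & dforces_notin r c Q]] rho.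

End Multi.

(* The ground universe V is the ambient type theory.  Elements of V[G] are
   given by P-names, and a statement about V[G] is represented by the set of
   conditions that force it, computed by the usual recursive clauses of the
   forcing relation.  A statement holds in V[G] for every G generic over V iff
   every condition forces it (`forced`).  Quantifiers over ground-model objects
   (nat, bool, trees, real names) range over the corresponding Rocq types. *)

(* A preordered set of conditions with a weakest element. *)
Record notion := Notion {
  cnd : Type;
  cle : cnd -> cnd -> Prop;
  cone : cnd;
  cle_refl : forall p, cle p p;
  cle_trans : forall p q r, cle p q -> cle q r -> cle p r;
  cle_one : forall p, cle p cone }.

Arguments cle {n} _ _.
Arguments cone {n}.

Section Forcing.
Variable F : notion.

Local Notation "q <= p" := (@cle F q p).

Definition fprop := cnd F -> Prop.

Implicit Types (p q r : cnd F) (phi psi : fprop).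

Definition dense_below p (D : fprop) : Prop :=
  forall q, q <= p -> exists2 r, r <= q & D r.

Definition fand phi psi : fprop := fun p => phi p /\ psi p.
Definition fnot phi : fprop := fun p => forall q, q <= p -> ~ phi q.
Definition fall (I : Type) (phi : I -> fprop) : fprop :=
  fun p => forall i, phi i p.
Definition fex (I : Type) (phi : I -> fprop) : fprop :=
  fun p => dense_below p (fun q => exists i, phi i q).
Definition fimp phi psi : fprop := fnot (fand phi (fnot psi)).
Definition fiff phi psi : fprop := fand (fimp phi psi) (fimp psi phi).

Definition fground (A : Prop) : fprop := fun _ => A.

(* p belongs to the generic filter *)
Definition fgen p : fprop := fun q => dense_below q (fun r => r <= p).

Definition forced phi : Prop := forall p, phi p.

(* `Name elt wt` is the name { (elt a, wt a) : a in A }, with value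
   { (elt a)[G] : a in A, wt a in G }. *)
Inductive name : Type :=
  Name (A : Type) (elt : A -> name) (wt : A -> cnd F).

Fixpoint feq (x y : name) : fprop :=
  match x, y with
  | Name A f w, Name B g v => fun p =>
      (forall a q, q <= p -> q <= w a ->
         dense_below q (fun r => exists b, r <= v b /\ feq (f a) (g b) r)) /\
      (forall b q, q <= p -> q <= v b ->
         dense_below q (fun r => exists a, r <= w a /\ feq (f a) (g b) r))
  end.

Definition fmem (x y : name) : fprop :=
  match y with
  | Name B g v => fun p =>
      dense_below p (fun r => exists b, r <= v b /\ feq x (g b) r)
  end.

(* Names of unordered pairs, Kuratowski pairs and von Neumann numerals. *)
Definition upair (x y : name) : name :=
  Name (fun b : bool => if b then x else y) (fun _ => cone).
Definition opair (x y : name) : name := upair (upair x x) (upair x y).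
Definition nsucc (x : name) : name :=
  match x with
  | Name A f w => Name (fun o : option A => if o is Some a then f a else x)
                       (fun o => if o is Some a then w a else cone)
  end.
Fixpoint num (n : nat) : name :=
  if n is m.+1 then nsucc (num m)
  else Name (fun e : void => match e with end) (fun _ => cone).

(* the ordered pair (n, i), for n in omega and i in 2 = {0, 1} *)
Definition npair (n : nat) (i : bool) : name := opair (num n) (num i).

(* x is an element of 2^omega, i.e. a function from omega to 2 *)
Definition freal (x : name) : fprop :=
  fand (fall (fun z : name => fimp (fmem z x)
          (fex (fun k : nat * bool => feq z (npair k.1 k.2)))))
 (fand (fall (fun n : nat => fex (fun i : bool => fmem (npair n i) x)))
       (fall (fun n : nat =>
          fnot (fand (fmem (npair n false) x) (fmem (npair n true) x))))).

Definition fsub (s : seq bool) (x : name) : fprop :=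
  fall (fun n : 'I_(size s) => fmem (npair n (nth false s n)) x).

(* Every s in 2^{<omega} with s subset x lies in T.  For x in 2^omega this is
   x in [T].  For x a possibly partial function, its negation still says that
   some finite s subset x is outside T, so that no total extension of x is
   in [T]. *)
Definition fbranch (x : name) (T : tree) : fprop :=
  fall (fun s : seq bool => fimp (fsub s x) (fground (T s))).

End Forcing.

Section ForcingMT.
Variables (W : choiceType) (pi : multiforcing W).

Lemma mle_refl (p : multitree W) : mle p p.
Proof. by move=> xi ?; split. Qed.

Lemma mle_trans (p q r : multitree W) : mle p q -> mle q r -> mle p r.
Proof.
move=> pq qr xi /qr[/pq[xip pq'] qr']; split=> //.
exact: subset_trans pq' qr'.
Qed.

Lemma MT0 : MT pi (fmap0 : multitree W).
Proof. by move=> xi; rewrite inE. Qed.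

Lemma mle0 (p : multitree W) : mle p fmap0.
Proof. by move=> xi; rewrite inE. Qed.

Definition MTn : notion :=
  @Notion {p : multitree W | MT pi p} (fun q p => mle (sval q) (sval p))
    (exist _ _ MT0) (fun p => @mle_refl (sval p))
    (fun p q r => @mle_trans (sval p) (sval q) (sval r))
    (fun p => @mle0 (sval p)).

Definition in_all (xi : W) (x : name MTn) : fprop MTn :=
  fand (freal x)
       (fall (fun p : cnd MTn =>
          fimp (fand (fgen p) (fground (xi \in domf (sval p))))
               (fbranch x (mtval (sval p) xi)))).

(* y = x_xi[G], as a definite description: y is the unique real belonging to
   every [p(xi)] with p in G and xi in |p|. *)
Definition is_xgen (xi : W) (y : name MTn) : fprop MTn :=
  fand (in_all xi y) (fall (fun z => fimp (in_all xi z) (feq z y))).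

(* The name of c[G] as a set of pairs: (n, i) is in it iff G meets K_{n,i}. *)
Definition ceval (c : rname W) : name MTn :=
  Name (fun k : {k : cnd MTn * (nat * bool) | c (sval k.1, k.2)} =>
          npair MTn (sval k).2.1 (sval k).2.2)
       (fun k => (sval k).1).

End ForcingMT.

(* Main.v *)
Require Import Defs.

(** For (i), let [q] force [x] to be a real other than [x_xi].  For each [n]
    take a maximal antichain of conditions that either extend [q] and decide
    [x(n)], or are incompatible with [q]; a condition of the second kind is
    declared to give [c(n)] the value [0].  The antichains are countable by ccc,
    and regularity with Koenig's lemma turns incompatibility into sadness, so
    [c] is a small complete real name with [x = c] below [q].  It is
    non-principal: below [q] some condition excludes [x] from [p(xi)] since [x]
    is not the generic real, and away from [q] the name evaluates to the
    constant zero sequence, which a perfect tree can be shrunk to avoid.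
    Conversely, non-principality makes a dense set of conditions [p] force [c]
    out of [p(xi)], which contains [x_xi].  For (ii), sealing yields [q] and
    finitely many [u'] covering [u]; any point of [u] lies in one of them, and
    relative clopenness lets [u] be refined below that [u']. *)

Set Implicit Arguments.
Unset Strict Implicit.
Unset Printing Implicit Defensive.

Local Open Scope classical_set_scope.

(** * The forcing relation: monotonicity and the laws of equality and membership *)

Section ForcingRelation.
Variable F : notion.
Implicit Types (p q r : cnd F) (phi psi : fprop F) (x y z : name F).

Definition fmono phi := forall p q, cle q p -> phi p -> phi q.

(** [fimp] is coded through [fnot], so it delivers [psi] only after a further strengthening of the
    condition. *)
Lemma fimpP phi psi p :
  fimp phi psi p <->
  forall q, cle q p -> phi q -> exists2 r, cle r q & psi r.
Proof.
split=> [h q qp hq|h q qp [hq nq]].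
  apply: contrapT => n; apply: (h q qp); split=> // r rq hr; apply: n.
  by exists r.
by have [r rq /(nq r rq)] := h q qp hq.
Qed.

Lemma dense_below_mono p q (D : fprop F) :
  cle q p -> dense_below p D -> dense_below q D.
Proof. by move=> qp h r /cle_trans/(_ qp)/h. Qed.

Lemma fimp_mono phi psi : fmono (fimp phi psi).
Proof. by move=> p q qp h r /cle_trans/(_ qp)/h. Qed.

Lemma fall_mono I (phi : I -> fprop F) :
  (forall i, fmono (phi i)) -> fmono (fall phi).
Proof. by move=> h p q qp hp i; apply: h (hp i). Qed.

Lemma fand_mono phi psi : fmono phi -> fmono psi -> fmono (fand phi psi).
Proof. by move=> h k p q qp [/(h _ _ qp) hp /(k _ _ qp)]. Qed.

Lemma dense_below_bind p (D E : fprop F) :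
  dense_below p D ->
  (forall r, cle r p -> D r -> exists2 s, cle s r & E s) -> dense_below p E.
Proof.
move=> hD h q qp; have [r rq /h] := hD q qp.
by case=> [|s sr Es]; [apply: cle_trans qp|exists s => //; apply: cle_trans rq].
Qed.

Lemma feq_mono x y : fmono (feq x y).
Proof.
case: x y => A f w [B g v] p q qp [h1 h2].
by split=> [a r rq|b r rq]; [apply: h1|apply: h2]; apply: cle_trans qp.
Qed.

Lemma fmem_mono x y : fmono (fmem x y).
Proof. by case: y => B g v p q; apply: dense_below_mono. Qed.

Lemma fsub_mono s x : fmono (fsub s x).
Proof. by apply: fall_mono => n; apply: fmem_mono. Qed.

Lemma fbranch_mono x T : fmono (fbranch x T).
Proof. by apply: fall_mono => s; apply: fimp_mono. Qed.

Lemma freal_mono x : fmono (freal x).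
Proof.
apply: fand_mono; first by apply: fall_mono => z; apply: fimp_mono.
apply: fand_mono; apply: fall_mono => n p q qp h r /cle_trans/(_ qp)/h //.
Qed.

Lemma feq_refl x p : feq x x p.
Proof.
elim: x p => A f IH w p.
by split=> a q qp qw r rq; exists r; rewrite ?cle_refl //; try exact: cle_refl;
  exists a; split=> //; apply: cle_trans qw.
Qed.

Lemma feq_sym x y p : feq x y p -> feq y x p.
Proof.
elim: x y p => A f IH w [B g v] p [h1 h2]; split.
  move=> b q qp qv s /(h2 b q qp qv)[r rs [c [rc /IH e]]].
  by exists r => //; exists c.
move=> a q qp qw s /(h1 a q qp qw)[r rs [c [rc /IH e]]].
by exists r => //; exists c.
Qed.

Lemma feq_trans x y z p : feq x y p -> feq y z p -> feq x z p.
Proof.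
elim: x y z p => A f IH w [B g v] [C h u] p [h1 h2] [k1 k2]; split.
  move=> a q qp qw; apply: (dense_below_bind (h1 a q qp qw)) => r rq [b [rv e]].
  have [s sr [c [su e']]] :=
    k1 b r (cle_trans rq qp) rv r (cle_refl r).
  by exists s => //; exists c; split=> //; apply: IH e'; apply: feq_mono e.
move=> c q qp qu; apply: (dense_below_bind (k2 c q qp qu)) => r rq [b [rv e]].
have [s sr [a [su e']]] :=
  h2 b r (cle_trans rq qp) rv r (cle_refl r).
by exists s => //; exists a; split=> //; apply: IH e' _; apply: feq_mono e.
Qed.

Lemma fmem_eql x y z p : feq x y p -> fmem x z p -> fmem y z p.
Proof.
case: z => C h u e m; apply: (dense_below_bind m) => r rp [c [ru e']].
exists r; first exact: cle_refl.
exists c; split=> //; apply: feq_trans e'; apply: feq_sym.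
exact: feq_mono e.
Qed.

Lemma fmem_eqr x y z p : feq x y p -> fmem z x p -> fmem z y p.
Proof.
case: x y => A f w [B g v] [h1 h2] m.
apply: (dense_below_bind m) => r rp [a [rw e]].
have [s sr [b [sv e']]] := h1 a r rp rw r (cle_refl r).
by exists s => //; exists b; split=> //; apply: feq_trans e'; apply: feq_mono e.
Qed.

Lemma fsub_eqr s x y p : feq x y p -> fsub s x p -> fsub s y p.
Proof. by move=> e h n; apply: fmem_eqr e (h n). Qed.

(** [T s] is a ground fact, independent of the condition, so merely failing to force the branch
    statement already exhibits a bad [s]. *)
Lemma not_fbranch x T p : ~ fbranch x T p ->
  exists s q, [/\ ~ T s, cle q p & fsub s x q].
Proof.
move=> /existsNP[s /existsNP[q /not_implyP[qp /contrapT[hs /(_ q (cle_refl q))]]]].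
by exists s, q.
Qed.

Lemma fbranch_fsub x T s p : fbranch x T p -> fsub s x p -> T s.
Proof. by move=> /(_ s)/fimpP/(_ p (cle_refl p)) h /h[]. Qed.

End ForcingRelation.

(** * Trees: branches, cylinders and relatively clopen sets *)

Section Trees.
Implicit Types (s t : seq bool) (S T R : tree) (x : cantor_space).

Lemma prefix_mkseq x m n : (m <= n)%N -> prefix (mkseq x m) (mkseq x n).
Proof.
move=> mn; apply/prefixP; exists (mkseq (fun k => x (m + k)%N) (n - m)).
rewrite /mkseq -{1}(subnKC mn) iotaD map_cat add0n; congr (_ ++ _).
by rewrite -{1}[m]addn0 iotaDl -map_comp.
Qed.

(** Iterating a chosen one-bit extension from [s] produces the branch. [P] is arbitrary so as to
    serve perfect trees and Koenig's lemma alike. *)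
Lemma branch_through (P : set (seq bool)) s : P s ->
  (forall t, P t -> exists b, P (rcons t b)) ->
  exists x, mkseq x (size s) = s /\
    forall n, (size s <= n)%N -> P (mkseq x n).
Proof.
move=> Ps hP.
have /choice[f fP] : forall t, exists b, P t -> P (rcons t b).
  by move=> t; have [/hP[b ?]|nt] := EM (P t); [exists b|exists false].
pose it n := iter n (fun t => rcons t (f t)) s.
have Pit n : P (it n) by elim: n => //= n; apply: fP.
have sit n : size (it n) = (size s + n)%N.
  by elim: n => [|n IH]; rewrite ?addn0 //= size_rcons IH addnS.
have nit m n k : (k < size (it m))%N -> (m <= n)%N ->
    nth false (it n) k = nth false (it m) k.
  move=> km /subnKC <-; elim: (n - m)%N => [|j IH]; rewrite ?addn0 //.
  rewrite addnS [it _.+1]/= nth_rcons ifT //.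
  by apply: leq_trans km _; rewrite !sit leq_add2l leq_addr.
(* Stage [k.+1] is longer than [k] even for empty [s], so its bit [k] never changes afterwards. *)
pose x : cantor_space := fun k => nth false (it k.+1) k.
have xit n : mkseq x (size s + n) = it n.
  apply: (@eq_from_nth _ false); rewrite size_mkseq ?sit // => k kn.
  rewrite nth_mkseq // /x; have [nk|kn'] := leqP n k.+1.
    by apply: nit => //; rewrite sit.
  by apply/esym/nit; rewrite ?sit ?leq_addl // ltnW.
exists x; split; first by rewrite -[size s]addn0 xit.
by move=> n /subnKC <-; rewrite xit.
Qed.

Lemma perfect_branch T s : PT T -> T s ->
  exists2 x, branches T x & mkseq x (size s) = s.
Proof.
move=> [_ pT spT] Ts; have [t Tt|x [xs xT]] := branch_through Ts.
  have [u [/prefixP[[|b v] ->] Tu0 Tu1]] := spT t Tt.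
    by exists false; rewrite cats0 in Tu0.
  by exists b; apply: pT _ Tu0; rewrite -cat_rcons rcons_cat prefix_prefix.
exists x => // n; have [|/ltnW sn] := leqP (size s) n; first exact: xT.
by apply: pT (prefix_mkseq x sn) _; apply: xT.
Qed.

(** A node with infinitely many extensions in [T] has a one-bit extension of the same kind,
    otherwise only the node and two finite sets would remain. *)
Lemma konig T : (forall s t, prefix s t -> T t -> T s) -> infinite_set T ->
  branches T !=set0.
Proof.
move=> pT iT; pose P s := infinite_set (T `&` [set t | prefix s t]).
have P0 : P [::].
  move: iT; apply: contra_not => /=; apply: sub_finite_set => t Tt.
  by split => //=; rewrite prefix0s.
have [s Ps|x [_ xP]] := branch_through P0.
  apply: contrapT => /forallNP h.
  have /contrapT f0 := h false; have /contrapT f1 := h true.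
  apply: Ps; apply: (@sub_finite_set _ _ ([set s] `|`
     (T `&` [set t | prefix (rcons s false) t] `|`
      T `&` [set t | prefix (rcons s true) t]))).
    move=> t [Tt /= /prefixP[[|b u] e]]; first by left; rewrite e cats0.
    right; subst t; rewrite -cat_rcons in Tt *.
    by case: b Tt => ?; [right|left]; split=> //=; apply: prefix_prefix.
  by rewrite !finite_setU; split=> //; apply: finite_set1.
exists x => n; apply: contrapT => nT; apply: (xP n) => //.
rewrite (_ : _ `&` _ = set0) //; apply/seteqP; split=> // t [Tt /= xt].
by apply: nT; apply: pT xt Tt.
Qed.

(** The topology is that of pointwise convergence, and the filter generated by the cylinders around
    [x] converges pointwise to [x]. *)
Lemma nbhs_cylinder (U : set cantor_space) x : nbhs x U ->
  exists n, [set y | mkseq y n = mkseq x n] `<=` U.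
Proof.
pose C n := [set y : cantor_space | mkseq y n = mkseq x n].
have CS m n : (m <= n)%N -> C n `<=` C m.
  move=> mn y /(congr1 (take m)); rewrite /C /= /mkseq -!map_take.
  by rewrite take_iota (minn_idPl mn).
have FF : Filter (filter_from [set: nat] C).
  apply: filter_from_filter; first by exists 0%N.
  move=> i j _ _; exists (maxn i j) => // y Cy.
  by split; apply: CS Cy; rewrite ?leq_maxl ?leq_maxr.
have cvgF : filter_from [set: nat] C --> x.
  apply/pointwise_cvgP => n B /= nB; exists n.+1 => // y /=.
  move/(congr1 (fun s => nth false s n)); rewrite !nth_mkseq // => ->.
  exact: nbhs_singleton nB.
by move=> /cvgF[n _ CU]; exists n.
Qed.

(** Inside some cylinder around [x] every branch of [S] is a branch of [T], and by perfectness each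
    node of [S] in that cylinder lies on such a branch. *)
Lemma clopen_in_restr S T x : PT S -> PT T ->
  clopen_in (branches S `&` branches T) (branches S) ->
  branches S x -> branches T x -> exists n, restr S (mkseq x n) `<=` T.
Proof.
move=> PS [_ pT _] [/open_subspaceP[V oV VE] _] Sx Tx.
have Vx : V x.
  have : (branches S `&` branches T `&` branches S) x by [].
  by rewrite -VE => -[].
have [n nV] := nbhs_cylinder (open_nbhs_nbhs (conj oV Vx)).
exists n => t [St /orP[xt|tx]]; last exact: pT tx (Tx n).
have [y Sy yt] := perfect_branch PS St.
have : (V `&` branches S) y.
  split=> //; apply: nV => /=.
  move: xt => /prefixP[u e]; have nt : (n <= size t)%N.
    by rewrite e size_cat size_mkseq leq_addr.
  move: (congr1 (take n) yt); rewrite {2}e take_size_cat ?size_mkseq //.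
  by rewrite /mkseq -map_take take_iota (minn_idPl nt).
by rewrite VE => -[[_ Ty] _]; rewrite -yt; apply: Ty.
Qed.



(** An infinite intersection has a common branch by Koenig's lemma; regularity then tells which of
    the two trees, restricted along that branch, falls inside the other. *)
Lemma regular_arboreal_refine (P : set tree) S T : arboreal P -> regular_arboreal P ->
  P S -> P T -> ~ almost_disjoint S T -> exists2 R, P R & R `<=` S `&` T.
Proof.
move=> [PP rP] reg PS PT_.
have [[_ pS _] [_ pT _]] := (PP _ PS, PP _ PT_).
move=> /konig[s t st [St Tt]|x STx].
  by split; [apply: pS St|apply: pT Tt].
have [Sx Tx] : branches S x /\ branches T x by split=> n; case: (STx n).
have [c|c] := reg S T PS PT_.
  have [n nT] := clopen_in_restr (PP _ PS) (PP _ PT_) c Sx Tx.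
  exists (restr S (mkseq x n)); first by apply: rP.
  by move=> t tR; split; [case: tR|apply: nT].
have [n nS] : exists n, restr T (mkseq x n) `<=` S.
  by apply: clopen_in_restr => //; [apply: PP|apply: PP|rewrite setIC].
exists (restr T (mkseq x n)); first by apply: rP.
by move=> t tR; split; [apply: nS|case: tR].
Qed.

End Trees.

(** * Multitrees: compatibility, maximal antichains and direct forcing *)

Section Multitrees.
Variables (W : choiceType) (pi : multiforcing W).
Implicit Types (p q r : multitree W) (D : set (multitree W)) (eta : W).

Lemma mfvalE eta T : mfval pi eta T -> mfdom pi eta.
Proof. by rewrite /mfval /mfdom /=; case: (pi eta). Qed.

Definition mkmt (E : {fset W}) (F : W -> tree) : multitree W :=
  [fmap eta : E => F (val eta)]%fmap.

Lemma mtval_mkmt (E : {fset W}) (F : W -> tree) eta :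
  eta \in E -> mtval (mkmt E F) eta = F eta.
Proof.
move=> iE; rewrite /mtval /mkmt.
have iE' : eta \in domf (mkmt E F) by [].
by rewrite (in_fnd iE') /= ffunE.
Qed.

Lemma mtval_set p xi T eta :
  mtval p.[xi <- T]%fmap eta = if eta == xi then T else mtval p eta.
Proof. by rewrite /mtval fnd_set; case: eqP. Qed.

Lemma mtval_cat p q eta :
  mtval (catf p q) eta = if eta \in domf q then mtval q eta else mtval p eta.
Proof. by rewrite /mtval fnd_cat; case: ifP. Qed.

Lemma compatible_sym p q : compatible pi p q -> compatible pi q p.
Proof. by move=> [r [? ? ?]]; exists r. Qed.

(** In a finite-support product the coordinates are refined independently: a chosen [R] at each
    common index, the given tree at every other. *)
Lemma compatibleP p q : MT pi p -> MT pi q ->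
  (forall eta, eta \in domf p -> eta \in domf q ->
    exists2 R, mfval pi eta R & R `<=` mtval p eta `&` mtval q eta) ->
  compatible pi p q.
Proof.
move=> hp hq h.
have /choice[F FP] : forall eta, exists R, eta \in domf p -> eta \in domf q ->
    mfval pi eta R /\ R `<=` mtval p eta `&` mtval q eta.
  move=> eta; have [[ip iq]|n] := EM (eta \in domf p /\ eta \in domf q).
    by have [R hR sR] := h eta ip iq; exists R.
  by exists set0 => jp jq; case: n.
pose G eta := if eta \in domf p then
  if eta \in domf q then F eta else mtval p eta else mtval q eta.
exists (mkmt (domf p `|` domf q)%fset G); split=> eta.
- move=> /= i; rewrite mtval_mkmt // /G; move: i; rewrite inE.
  case: (boolP (eta \in domf p)) => [ip|_] /=; last exact: hq.
  by move=> _; case: ifPn => [iq|_]; [split; [case: (hp _ ip)|case: (FP _ ip iq)]|apply: hp].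
- move=> ip; have i : eta \in (domf p `|` domf q)%fset by rewrite inE ip.
  split=> //; rewrite mtval_mkmt // /G ip; case: ifPn => [iq|_]; last exact: subset_refl.
  by have [_ s] := FP _ ip iq => t /s[].
- move=> iq; have i : eta \in (domf p `|` domf q)%fset by rewrite inE iq orbT.
  split=> //; rewrite mtval_mkmt // /G iq; case: ifPn => [ip|_]; last exact: subset_refl.
  by have [_ s] := FP _ ip iq => t /s[].
Qed.

Lemma incompatible_sad p q : is_multiforcing pi -> regular pi ->
  MT pi p -> MT pi q -> ~ compatible pi p q -> sad p q.
Proof.
move=> hpi hreg hp hq; apply: contra_notP => ns; apply: compatibleP => // eta ip iq.
have [[d Tp] [_ Tq]] := (hp _ ip, hq _ iq).
apply: (regular_arboreal_refine (hpi _ d) (hreg _ d)) => // ad.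
by apply: ns; exists eta.
Qed.

Definition antichain D :=
  forall p q, D p -> D q -> p <> q -> ~ compatible pi p q.

(** Zorn's lemma is applied to antichains inside [D]; density of [D] carries maximality over to all
    of [MT pi]. *)
Lemma maximal_antichain D : D `<=` MT pi ->
  (forall p, MT pi p -> exists2 q, D q & mle q p) ->
  exists A, [/\ A `<=` D, antichain A
    & forall p, MT pi p -> exists2 a, A a & compatible pi p a].
Proof.
move=> DM dD.
have [F FP tF|A [[AD aA] maxA]] :=
  @Zorn_bigcup _ [set A | A `<=` D /\ antichain A].
  split=> [p [A FA Ap]|p q [A FA Ap] [B FB Bq]]; first exact: (FP A FA).1 Ap.
  have [AB|BA] := tF A B FA FB.
    exact: (FP B FB).2 (AB _ Ap) Bq.
  exact: (FP A FA).2 Ap (BA _ Bq).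
exists A; split=> // p hp; have [q Dq qp] := dD p hp.
suff [a Aa [r [hr rq ra]]] : exists2 a, A a & compatible pi q a.
  by exists a => //; exists r; split=> //; apply: mle_trans qp.
apply: contrapT => n.
have {}n a : A a -> ~ compatible pi q a by move=> Aa c; apply: n; exists a.
(* [q] is compatible with itself, so adjoining it enlarges [A] properly. *)
have Aq : ~ A q.
  by move=> Aq; apply: (n q Aq); exists q; split; [apply: DM|apply: mle_refl|
    apply: mle_refl].
apply: (maxA (q |` A)); first by split=> [a|/(_ q)]; [right|move=> h; apply/Aq/h; left].
split=> [a [->//|/AD//]|a b [->|Aa] [->|Ab] //]; first by move=> _; apply: n.
- by move=> _ /compatible_sym; apply: n.
- exact: aA.
Qed.

Lemma dforces_bit_mono p q c n i :
  mle q p -> dforces_bit p c n i -> dforces_bit q c n i.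
Proof. by move=> qp [k ck /(mle_trans qp)]; exists k. Qed.

Lemma dforces_seq_mono p q c s :
  mle q p -> dforces_seq p c s -> dforces_seq q c s.
Proof. by move=> qp h n /h; apply: dforces_bit_mono. Qed.

Lemma dforces_notin_mono p q c S T : mle q p -> T `<=` S ->
  dforces_notin p c S -> dforces_notin q c T.
Proof.
by move=> qp TS [s nS /(dforces_seq_mono qp)]; exists s => // /TS.
Qed.

(** Direct forcing does not refer to a multiforcing, so an arbitrary one is allowed here: [pi] for
    (i), [cwU pi rho] for (ii). *)
Lemma dforces_bit_fmem (rho : multiforcing W) (c : rname W) (p : cnd (MTn rho)) n i :
  name_in rho c -> dforces_bit (sval p) c n i ->
  fmem (npair _ n i) (ceval rho c) p.
Proof.
move=> hc [k ck pk] q qp; exists q; first exact: cle_refl.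
exists (exist _ (exist _ k (hc _ ck), (n, i)) ck); split; last exact: feq_refl.
exact: mle_trans qp pk.
Qed.

Lemma dforces_seq_fsub (rho : multiforcing W) (c : rname W) (p : cnd (MTn rho)) s :
  name_in rho c -> dforces_seq (sval p) c s -> fsub s (ceval rho c) p.
Proof. by move=> hc h n; apply: dforces_bit_fmem => //; apply: h. Qed.

End Multitrees.

(** * Part (i): small names for reals, and non-principality *)

Section RealNames.
Variables (W : choiceType) (pi : multiforcing W).
Hypotheses (hpi : is_multiforcing pi) (hreg : regular pi).
Implicit Types (p q r : cnd (MTn pi)) (x y : name (MTn pi)) (c : rname W).

(** Completeness in density form: [p] itself can be strengthened so as to decide the bit. *)
Definition decides_all_bits c :=
  forall n p, exists r i, cle r p /\ dforces_bit (sval r) c n i.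

Definition bits_correct_below c x q :=
  forall n i r, cle r q -> dforces_bit (sval r) c n i ->
    fmem (npair _ n i) x r.

Definition zero_away_from c q :=
  forall n i r, ~ compatible pi (sval r) (sval q) ->
    dforces_bit (sval r) c n i -> i = false.

Lemma is_xgen_mono xi y : fmono (is_xgen xi y).
Proof.
apply: fand_mono; last by apply: fall_mono => z; apply: fimp_mono.
by apply: fand_mono (@freal_mono _ _) _; apply: fall_mono => p; apply: fimp_mono.
Qed.

Lemma decides_all_bits_complete c : decides_all_bits c -> complete pi c.
Proof.
move=> hc n p hp; have [[r hr] [i [rp [k ck rk]]]] := hc n (exist _ p hp).
exists r; last by exists r; split=> //; apply: mle_refl.
by split=> //; exists k => //; case: i ck; [right|left].
Qed.

Lemma decides_initial c n p : decides_all_bits c ->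
  exists r s, [/\ cle r p, size s = n & dforces_seq (sval r) c s].
Proof.
move=> hc; elim: n => [|n [q [s [qp ss hs]]]].
  by exists p, [::]; split=> //; apply: cle_refl.
have [r [i [rq ri]]] := hc n q; exists r, (rcons s i); split.
- exact: cle_trans qp.
- by rewrite size_rcons ss.
move=> m; rewrite size_rcons ss ltnS leq_eqVlt nth_rcons ss.
case: eqP => [->|_] /=; first by rewrite ltnn.
by move=> mn; rewrite mn; apply: dforces_bit_mono rq _; apply: hs; rewrite ss.
Qed.

(** Each antichain member lies below [q] or is incompatible with it, so the bits read from [x] and
    the default bits never interfere. *)
Lemma real_name_below x q : ccc pi -> freal x q -> exists c,
  [/\ is_real_name c, name_in pi c & small c] /\
  [/\ decides_all_bits c, bits_correct_below c x q & zero_away_from c q].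
Proof.
move=> hccc [_ [xtot xfun]].
pose dec n i (r : multitree W) := mle r (sval q) /\
  exists h : MT pi r, fmem (npair _ n i) x (exist _ r h).
pose away (r : multitree W) := MT pi r /\ ~ compatible pi r (sval q).
pose D n : set (multitree W) := [set r | (exists i, dec n i r) \/ away r].
have DM n : D n `<=` MT pi by move=> r [[i [_ [h]]]|[]].
have /choice[A AP] : forall n, exists A, [/\ A `<=` D n, antichain pi A
    & forall p : multitree W, MT pi p -> exists2 a, A a & compatible pi p a].
  move=> n; apply: maximal_antichain => // p hp.
  have [[r [hr rp rq]]|np] := EM (compatible pi p (sval q)).
    have [[s hs] sr [i xi]] := xtot n (exist _ r hr) rq.
    exists s; last exact: mle_trans rp.
    by left; exists i; split; [apply: mle_trans rq|exists hs].
  by exists p; [right|apply: mle_refl].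
(* Nothing is known about [x] away from [q]; the default bit [false] there makes the name decide
   every bit everywhere. *)
pose c : rname W := [set k | A k.2.1 k.1 /\
  (dec k.2.1 k.2.2 k.1 \/ (k.2.2 = false /\ away k.1))].
have cM : name_in pi c by move=> [k [n i]] [/= Ak _]; apply: DM; case: (AP n) => + _ _; apply.
have nboth (r : multitree W) : mle r (sval q) -> ~ away r.
  by move=> rq [hr]; apply; exists r; split=> //; apply: mle_refl.
exists c; split; split=> //.
- split=> [k /cM kM eta /kM[d]|n p r [/= Ap cp] [/= Ar cr]].
    by case: (hpi d) => + _; apply.
  (* A condition carrying the bit [true] lies below [q]. If the two conditions coincided, it would
     force both bits of [x], so they are distinct members of an antichain. *)
  case: cr => [[rq [hr fr]]|[]//].
  apply: (@incompatible_sad _ pi) => //.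
    by case: (AP n) => /(_ _ Ap)/DM.
  case: (AP n) => _ aA _; apply: aA => // pr; subst p.
  case: cp => [[_ [hr' fr']]|[_ /(nboth _ rq)//]].
  apply: (xfun n (exist _ r hr) rq); split=> //.
  by apply: fmem_mono fr'; apply: mle_refl.
- move=> n; apply: (sub_countable (B := A n)).
    by apply: subset_card_le => k [[]|[]].
  by have [AD aA _] := AP n; apply: hccc => // a /AD/DM.
- move=> n p; have [AD _ /(_ _ (svalP p))[a Aa [r [hr rp ra]]]] := AP n.
  have [[i di]|aw] := AD a Aa.
    by exists (exist _ r hr), i; split=> //; exists a => //; split=> //; left.
  by exists (exist _ r hr), false; split=> //; exists a => //; split=> //; right.
- move=> n i r rq [k [_ [[_ [hk fk]]|[_ [_ nk]]]] rk]; first exact: fmem_mono fk.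
  by case: nk; exists (sval r); split=> //; apply: svalP.
- move=> n i r nr [k [_ [[kq _]|[//]]] rk]; case: nr.
  exists (sval r); split; [exact: svalP|exact: mle_refl|exact: mle_trans kq].
Qed.

(** An element of [x] is forced to be some pair [(n, i)], and the bit that [c] decides at [n] must
    be [i] because [x] is a function. The other inclusion is correctness. *)
Lemma feq_ceval c x q : name_in pi c -> freal x q ->
  decides_all_bits c -> bits_correct_below c x q -> feq x (ceval pi c) q.
Proof.
move=> cM [xpairs [_ xfun]] hdec hcor; case: x xpairs xfun hcor => A f w xpairs xfun hcor.
split=> [a p pq pa|[[k [n i]] /= ck] p pq pk].
  move=> q' q'p.
  have fa : fmem (f a) (Name f w) q'.
    move=> r rq'; exists r; first exact: cle_refl.
    by exists a; split; [apply: cle_trans rq' (cle_trans q'p pa)|apply: feq_refl].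
  have /fimpP/(_ q' (cle_trans q'p pq) fa)[r rq' hr] := xpairs (f a).
  have [s sr [[n i] /= e]] := hr r (cle_refl r).
  have [t [j [ts tj]]] := hdec n s.
  have tq' := cle_trans ts (cle_trans sr rq').
  have tq := cle_trans tq' (cle_trans q'p pq).
  have e' := feq_mono ts e.
  have mi : fmem (npair _ n i) (Name f w) t.
    by apply: fmem_eql e' _; apply: fmem_mono fa.
  have mj := hcor n j t tq tj.
  have ij : i = j.
    by case: i j mi mj {tj e e'} => [] [] // mi mj; case: (xfun n t tq).
  subst j; exists t => //.
  have [k ck tk] := tj.
  exists (exist _ (exist _ k (cM _ ck), (n, i)) ck); split=> //.
have bp : dforces_bit (sval p) c n i by exists (sval k).
apply: dense_below_bind (hcor n i p pq bp) _ => r rp [a [ra e]].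
by exists r; [apply: cle_refl|exists a; split=> //; apply: feq_sym].
Qed.

(** By the uniqueness clause for [y], a real different from [y] must be excluded from the tree at
    [xi] of some condition [t] in the generic filter. *)
Lemma dforces_notin_generic c x y xi q p : freal x q -> is_xgen xi y q ->
  fnot (feq x y) q -> decides_all_bits c -> bits_correct_below c x q ->
  cle p q -> exists r, [/\ cle r p, xi \in domf (sval r)
    & dforces_notin (sval r) c (mtval (sval r) xi)].
Proof.
move=> xr [_ ygen] xy hdec hcor pq.
have nall : ~ in_all xi x p.
  move=> xall; have /fimpP/(_ p pq xall)[r rp e] := ygen x.
  exact: xy r (cle_trans rp pq) e.
have [t nt] : exists t : cnd (MTn pi), ~ fimp (fand (fgen t) (fground (xi \in domf (sval t))))
    (fbranch x (mtval (sval t) xi)) p.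
  by apply/existsNP => h; apply: nall; split=> //; apply: freal_mono xr.
have [p' [p'p [gt it] nb]] : exists p', [/\ cle p' p,
    fand (fgen t) (fground (xi \in domf (sval t))) p'
    & ~ fbranch x (mtval (sval t) xi) p'].
  apply: contrapT => h; apply: nt; apply/fimpP => r rp hr.
  exists r; first exact: cle_refl.
  by apply: contrapT => nb; apply: h; exists r.
have [s [p2 [ns p2p' fs]]] := not_fbranch nb.
have [p3 p3p2 p3t] := gt p2 p2p'.
(* [c] is decided up to the length of the excluded [s]; correctness and functionality of [x] then
   give [s = s']. *)
have [r [s' [rp3 ss hs]]] := decides_initial (size s) p3 hdec.
have rp2 := cle_trans rp3 p3p2.
have rp := cle_trans rp2 (cle_trans p2p' p'p).
have [ir sr] := mle_trans rp3 p3t it.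
exists r; split=> //; exists s; first by move/sr.
suff -> : s = s' by [].
apply: (@eq_from_nth _ false) => // n ns'.
have rq := cle_trans rp pq.
have ms : fmem (npair _ n (nth false s n)) x r.
  exact: (fmem_mono rp2 (fs (Ordinal ns'))).
have ms' : fmem (npair _ n (nth false s' n)) x r.
  by apply: hcor => //; apply: hs; rewrite ss.
have [_ [_ xfun]] := xr.
by move: ms ms'; case: nth; case: nth => // m m'; case: (xfun n r rq).
Qed.

(** Incompatibly with [q] the name can only take the bit [0], so the tree at [xi] is shrunk to the
    [1] side of a splitting node [t], and bit [size t] separates the two. *)
Lemma dforces_notin_away c xi q p T0 : mfval pi xi T0 ->
  decides_all_bits c -> zero_away_from c q ->
  ~ compatible pi (sval p) (sval q) ->
  exists r, [/\ cle r p, xi \in domf (sval r)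
    & dforces_notin (sval r) c (mtval (sval r) xi)].
Proof.
move=> hT0 hdec hz np.
(* [T0] is the tree to shrink when [p] has none at [xi]. *)
pose T := if xi \in domf (sval p) then mtval (sval p) xi else T0.
have [PP rP] := hpi (mfvalE hT0).
have hT : mfval pi xi T.
  by rewrite /T; case: ifPn => // /(svalP p)[].
have [[t0 Tt0] _ spT] := PP _ hT.
have [t [_ _ Tt]] := spT _ Tt0.
pose R := restr T (rcons t true).
have hp2 : MT pi (sval p).[xi <- R]%fmap.
  move=> eta; rewrite mem_setf !inE mtval_set; case: eqP => [->|_] /= i.
    by split; [apply: mfvalE hT0|apply: rP].
  exact: (svalP p).
have p2p : mle (sval p).[xi <- R]%fmap (sval p).
  move=> eta i; rewrite mem_setf !inE i orbT mtval_set; split=> //.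
  by case: eqP => [e u []|_]; [rewrite /T -e i|apply: subset_refl].
have [r [s [rp2 ss hs]]] := decides_initial (size t).+1 (exist _ _ hp2) hdec.
have rp : cle r p := mle_trans rp2 p2p.
have [ir] := rp2 xi (fset1U1 _ _); rewrite mtval_set eqxx => rR.
exists r; split=> //; exists s => // /rR [_ h].
have sE : s = rcons t true.
  have st : size s = size (rcons t true) by rewrite size_rcons.
  by case/orP: h; rewrite prefixE; [rewrite -st|rewrite st];
    rewrite take_size => /eqP.
have := hs (size t); rewrite ss sE nth_rcons ltnn eqxx => /(_ (leqnn _)) h1.
suff : true = false by [].
apply: hz h1 => -[u [hu ur uq]]; apply: np.
by exists u; split=> //; apply: mle_trans rp.
Qed.

Lemma non_principal_below c x y xi q : freal x q -> is_xgen xi y q ->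
  fnot (feq x y) q -> decides_all_bits c -> bits_correct_below c x q ->
  zero_away_from c q -> non_principal pi c xi.
Proof.
move=> xr yg xy hdec hcor hz; split.
  move=> p r hr [hp ip np] rp; have [ir sr] := rp xi ip.
  by split=> //; apply: dforces_notin_mono np.
(* An arboreal forcing may be empty, so a tree at [xi] is taken from a condition already found below
   [q]. *)
have [T0 hT0] : exists T0, mfval pi xi T0.
  have [r [_ ir _]] := dforces_notin_generic xr yg xy hdec hcor (cle_refl q).
  by exists (mtval (sval r) xi); case: (svalP r _ ir).
move=> p hp.
have [[s [hs sp sq]]|np] := EM (compatible pi p (sval q)).
  have [r [rs ir nr]] :=
    @dforces_notin_generic c x y xi q (exist _ s hs) xr yg xy hdec hcor sq.
  by exists (sval r); [split=> //; apply: svalP|apply: mle_trans sp].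
have [r [rs ir nr]] := @dforces_notin_away c xi q (exist _ p hp) T0 hT0 hdec hz np.
by exists (sval r); [split=> //; apply: svalP|].
Qed.

(** If [x] and [y] agreed, a condition [r] pushing [c] off its own tree at [xi] would do the same to
    [y]; yet [r] forces itself into the generic filter, hence [y] into that tree. *)
Lemma non_principal_neq c xi x y q : name_in pi c -> non_principal pi c xi ->
  feq x (ceval pi c) q -> is_xgen xi y q -> fnot (feq x y) q.
Proof.
move=> cM [_ dnp] xc [[_ yall] _] p pq xy.
have [r [hr ir [s ns /(@dforces_seq_fsub _ _ _ (exist _ r hr) _ cM) hs]] rp] :=
  dnp (sval p) (svalP p).
pose r' : cnd (MTn pi) := exist _ r hr.
have rq : cle r' q by apply: cle_trans pq.
have sy : fsub s y r'.
  apply: fsub_eqr (feq_mono _ xy) _; first exact: rp.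
  by apply: fsub_eqr (feq_sym (feq_mono rq xc)) _.
have /fimpP/(_ r' rq)[|u ur yb] := yall r'.
  by split=> // u ur; exists u => //; apply: cle_refl.
by apply: ns; apply: fbranch_fsub yb (fsub_mono ur sy).
Qed.

End RealNames.

(** * Part (ii): sealing and the componentwise union *)

Section Sealing.
Variables (W : choiceType) (pi rho : multiforcing W).
Hypotheses (hpi : is_multiforcing pi) (hrho : is_multiforcing rho).
Implicit Types (p q r u v w : multitree W) (eta : W).

Lemma mfval_cwU eta T :
  mfval (cwU pi rho) eta T <-> mfval pi eta T \/ mfval rho eta T.
Proof.
rewrite /mfval /cwU; case: (pi eta) (rho eta) => [P|] [Q|] //=; split;
  by [left|right|case].
Qed.

Lemma MT_cwU p : MT (cwU pi rho) p <->
  forall eta, eta \in domf p ->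
    mfval pi eta (mtval p eta) \/ mfval rho eta (mtval p eta).
Proof.
split=> h eta /h; first by case=> _ /mfval_cwU.
by move=> /mfval_cwU m; split=> //; apply: mfvalE m.
Qed.

Lemma mbranches_nonempty u : MT rho u -> mbranches u !=set0.
Proof.
move=> hu; have /choice[x xP] : forall eta, exists x,
    eta \in domf u -> branches (mtval u eta) x.
  move=> eta; have [iu|_] := boolP (eta \in domf u); last by exists point.
  have [d m] := hu _ iu; have hT := (hrho d).1 _ m.
  have [[t Tt] _ _] := hT.
  by have [x] := perfect_branch hT Tt; exists x.
by exists x.
Qed.

(** At each index [[u]] meets [[v]] in a set clopen in [[u]], so the tree of [u] restricted along
    [x] enters that of [v] while staying in [rho]. *)
Lemma common_refinement u v x : mf_ext pi rho -> MT rho u -> MT pi v ->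
  domf v = domf u -> mbranches u x -> mbranches v x ->
  exists v', [/\ MT rho v', domf v' = domf u, mle v' u & mle v' v].
Proof.
move=> [_ ext] hu hv vu ux vx.
have /choice[F FP] : forall eta, exists R, eta \in domf u ->
    [/\ mfval rho eta R, R `<=` mtval u eta & R `<=` mtval v eta].
  move=> eta; have [iu|_] := boolP (eta \in domf u); last by exists set0.
  have iv : eta \in domf v by rewrite vu.
  have [[dr mu] [dp mv]] := (hu _ iu, hv _ iv).
  have [_ _ /(_ _ _ mu mv)[cl _]] := ext _ dp.
  have [n nR] := clopen_in_restr ((hrho dr).1 _ mu) ((hpi dp).1 _ mv) cl
    (ux _ iu) (vx _ iv).
  exists (restr (mtval u eta) (mkseq (x eta) n)) => _; split=> //.
    by apply: (hrho dr).2 => //; apply: ux.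
  by move=> t [].
exists (mkmt (domf u) F); split=> // eta i.
- by rewrite mtval_mkmt //; have [m _ _] := FP _ i; split=> //; apply: mfvalE m.
- by split=> //; rewrite mtval_mkmt //; case: (FP _ i).
- by rewrite vu in i; split=> //; rewrite mtval_mkmt //; case: (FP _ i).
Qed.

(* The trees of [w] outside [pi] at indices of [pi] are handed to the sealing
   condition as [u]; those at indices outside [pi] are carried along. *)
Lemma seal_dense (Delta : set (multitree W)) w : seal pi Delta rho ->
  MT (cwU pi rho) w ->
  exists r d, [/\ MT (cwU pi rho) r, mle r w, Delta d & mle r d].
Proof.
move=> [ext hseal] /MT_cwU hw.
pose inpi eta := `[< mfval pi eta (mtval w eta) >].
pose p := mkmt [fset eta in domf w | inpi eta]%fset (mtval w).
pose u := mkmt [fset eta in domf w | ~~ inpi eta && `[< mfdom pi eta >]]%fset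
  (mtval w).
have inp eta : eta \in domf p = (eta \in domf w) && inpi eta by rewrite !inE.
have inu eta : eta \in domf u =
    [&& eta \in domf w, ~~ inpi eta & `[< mfdom pi eta >]] by rewrite !inE.
have mp eta : eta \in domf p -> mtval p eta = mtval w eta.
  exact: mtval_mkmt.
have mu eta : eta \in domf u -> mtval u eta = mtval w eta.
  exact: mtval_mkmt.
have hp : MT pi p.
  move=> eta i; rewrite mp //; move: i; rewrite inp => /andP[_ /asboolP m].
  by split=> //; apply: mfvalE m.
have hu : MT rho u.
  move=> eta i; rewrite mu //; move: i; rewrite inu => /and3P[iw /asboolP nm _].
  by have [//|m] := hw _ iw; split=> //; apply: mfvalE m.
have upi eta : eta \in domf u -> mfdom pi eta.
  by rewrite inu => /and3P[_ _ /asboolP].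
have dup : mdisjoint u p.
  by move=> eta []; rewrite inu inp => /and3P[_ /negbTE -> _]; rewrite andbF.
have [q [hq qp dqu [Z [_ ZP _ cov]]]] := hseal p u hp hu upi dup.
(* One point of [u] suffices to select the member [u'] of the finite cover with which [u] has a
   common refinement. *)
have [x ux] := mbranches_nonempty hu.
have [u' /ZP[hu' u'u hD] u'x] := cov _ ux.
have [v [hv vu vleu vleu']] := common_refinement ext hu hu' u'u ux u'x.
pose r := mkmt (domf q `|` domf w)%fset (fun eta =>
  if eta \in domf q then mtval q eta else
  if eta \in domf u then mtval v eta else mtval w eta).
have uw eta : eta \in domf u -> eta \in domf w by rewrite inu => /and3P[].
have inr eta : eta \in domf r = (eta \in domf q) || (eta \in domf w).
  by rewrite !inE.
have mr eta : eta \in domf r -> mtval r eta =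
    if eta \in domf q then mtval q eta else
    if eta \in domf u then mtval v eta else mtval w eta.
  exact: mtval_mkmt.
exists r, (catf u' q); split=> //.
- apply/MT_cwU => eta i; rewrite mr //.
  case: ifPn => [/hq[]|nq]; first by left.
  case: ifPn => [iu|_]; first by rewrite -vu in iu; case: (hv _ iu); right.
  by apply: hw; move: i; rewrite inr (negbTE nq).
- move=> eta iw; have ir : eta \in domf r by rewrite inr iw orbT.
  split=> //; rewrite mr //; case: ifPn => [iq|_].
    (* An index common to [q] and [w] lies in [p]: otherwise, being an index of [pi], it would lie
       in [u], which [q] avoids. *)
    have [ip|] := boolP (eta \in domf p); first by have [_] := qp _ ip; rewrite mp.
    rewrite inp iw /= => np; case: (dqu eta); split=> //.
    by rewrite inu iw np; apply/asboolP; case: (hq _ iq).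
  case: ifPn => [iu|_]; last exact: subset_refl.
  by have [_] := vleu _ iu; rewrite mu.
- move=> eta; rewrite domf_cat inE orbC => i.
  have ir : eta \in domf r.
    rewrite inr; case/orP: i => [->//|]; rewrite u'u => /uw ->.
    by rewrite orbT.
  split=> //; rewrite mr // mtval_cat.
  case: ifPn i => [_ _|_]; first exact: subset_refl.
  by rewrite orFb => i; rewrite -u'u i; case: (vleu' _ i).
Qed.

End Sealing.

Theorem theorem12p2 (d : Order.disp_t) (W : orderType d) (hW : is_omega1 W)
  (pi : multiforcing W) (hpi : is_multiforcing pi) (hreg : regular pi)
  (xi : W) (hxi : mfdom pi xi) :
  (ccc pi ->
     forced (fall (fun x : name (MTn pi) => fall (fun y : name (MTn pi) =>
       fimp (fand (freal x) (is_xgen xi y))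
         (fiff (fnot (feq x y))
               (fex (fun c : rname W =>
                  fand (fground
                          [/\ is_real_name c, name_in pi c, small c,
                              complete pi c & non_principal pi c xi])
                       (feq x (ceval pi c))))))))) /\
  (forall c : rname W, is_real_name c -> name_in pi c -> complete pi c ->
   forall rho : multiforcing W, is_multiforcing rho -> avoids rho c pi xi ->
     forced (fall (fun Q : {Q : tree | mfval rho xi Q} =>
       fnot (fbranch (ceval (cwU pi rho) c) (sval Q))))).

Proof.
split.
  move=> hccc p0 x y; apply/fimpP => q _ [xr yg].
  exists q; first exact: cle_refl.
  split; apply/fimpP => p pq hp; exists p; try exact: cle_refl.
    (* [fex] lets the name vary with the condition, so one is built for each [p']. *)
    move=> p' p'p; exists p'; first exact: cle_refl.
    have p'q := cle_trans p'p pq.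
    have xr' := freal_mono p'q xr.
    have [c [[cn cM cs] [hdec hcor hz]]] := real_name_below hpi hreg hccc xr'.
    exists c; split; last exact: feq_ceval.
    split=> //; first exact: decides_all_bits_complete.
    apply: (non_principal_below hpi xr' _ _ hdec hcor hz).
      exact: is_xgen_mono yg.
    by move=> r rp'; apply: hp; apply: cle_trans p'p.
  move=> r rp xy; have [s sr [c [[_ cM _ _ np] xc]]] := hp r rp.
  have sq := cle_trans sr (cle_trans rp pq).
  apply: (non_principal_neq cM np xc (is_xgen_mono sq yg) (cle_refl s)).
  exact: feq_mono xy.
(* If [q] forced [c[G]] into [[Q]], sealing would give a stronger [r] that directly forces an
   initial segment outside [Q]. *)
move=> c cn cM cc rho hrho [ext av] w [Q hQ] q qw xQ.
have [r [t [hr rq [_ _ [s ns ts]] rt]]] :=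
  seal_dense hpi hrho (av Q hQ) (svalP q).
have cM' : name_in (cwU pi rho) c.
  by move=> k /cM hk; apply/MT_cwU => eta /hk[_]; left.
pose r' : cnd (MTn (cwU pi rho)) := exist _ r hr.
apply: ns; apply: (@fbranch_fsub _ (ceval (cwU pi rho) c) Q s r').
  by apply: fbranch_mono xQ.
by apply: dforces_seq_fsub => //; apply: dforces_seq_mono ts.
Qed.
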